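(* Let $A\in\mathcal{L}(X,Y)$, let $\Sigma_\varepsilon\in\mathcal{L}(Y,Y)$ be an injective covariance operator such that the compatibility assumption between $\Sigma_\varepsilon$ and $A$ holds, let $B\in\mathcal{L}(\ell^2,X)$ be such that $AB$ is finite basis injective, and let $y\in Y$. Then there exists a unique minimizer $\hat u_B=\hat u_B(y)\in\ell^2$ of the functional $$J_B(u)=\frac12\|\Sigma_\varepsilon^{-1/2}ABu\|_Y^2-\langle y,\Sigma_\varepsilon^{-1}ABu\rangle_Y+\|u\|_{\ell^1},\qquad u\in\ell^2,$$ and, consequently, a unique $\hat x_B=B\hat u_B\in X$.
   Context: $X,Y$ are real separable Hilbert spaces; $\mathcal{L}(\cdot,\cdot)$ denotes bounded linear operators with the operator norm; $\ell^2=\ell^2(\mathbb{N})$ with $\mathbb{N}=\{1,2,\dots\}$ and canonical basis $(e_i)$. $\Sigma_\varepsilon\colon Y\to Y$ is the covariance operator of a zero-mean square-integrable $Y$-valued random variable $\varepsilon$ (hence it is self-adjoint, positive and trace class) and is assumed injective; $\Sigma_\varepsilon^{-1}$ and $\Sigma_\varepsilon^{-1/2}$ denote the (possibly unbounded) inverses of $\Sigma_\varepsilon$ and $\Sigma_\varepsilon^{1/2}$, defined on $\operatorname{Im}(\Sigma_\varepsilon)$ and $\operatorname{Im}(\Sigma_\varepsilon^{1/2})$ respectively. Compatibility assumption: $\operatorname{Im}(A)\subset\operatorname{Im}(\Sigma_\varepsilon)$ and $\Sigma_\varepsilon^{-1}A\colon X\to Y$ is a compact operator. Finite basis injectivity (FBI)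 of $AB$: for every finite $I\subset\mathbb{N}$, the restriction of $AB$ to $\ell^2_I:=\operatorname{span}\{e_i:i\in I\}$ is injective. Convention: $\|u\|_{\ell^1}=+\infty$ if $u\in\ell^2\setminus\ell^1$. *)

(* Defs.v *)
From HB Require Import structures.
From mathcomp Require Import all_boot all_order all_algebra finmap.
From mathcomp Require Import all_classical all_reals all_analysis.
From mathcomp Require Import ring lra.

Set Implicit Arguments.
Unset Strict Implicit.
Unset Printing Implicit Defensive.
Import Order.TTheory GRing.Theory Num.Theory.
Import numFieldNormedType.Exports.
Local Open Scope classical_set_scope.
Local Open Scope ring_scope.

HB.mixin Record CompleteNormedModule_isHilbert (R : realType) V
    & CompleteNormedModule R V := {
  inner : {dot V for @idfun R} ;
  inner_norm : forall x : V, inner x x = `|x| ^+ 2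
}.

#[short(type="hilbertType")]
HB.structure Definition Hilbert (R : realType) :=
  {V of CompleteNormedModule R V & CompleteNormedModule_isHilbert R V}.

Definition separable (T : topologicalType) :=
  exists2 D : set T, countable D & dense D.

Section operators.
Context {R : realType}.

Definition bounded_operator (V W : normedModType R) (f : V -> W) :=
  exists M : R, forall x, `|f x| <= M * `|x|.

Lemma bounded_operatorP (V W : normedModType R) (f : {linear V -> W}) :
  bounded_operator f <-> continuous f.
Proof.
rewrite -linear_bounded_continuous linear_boundedP; split => [[M fM]|].
  have : \forall r \near +oo, M <= r by exact/nbhs_pinfty_ge/num_real.
  by apply: filterS => r Mr x; rewrite (le_trans (fM x))// ler_wpM2r.
by move=> /pinfty_ex_gt0[M _ fM]; exists M.
Qed.

Definition compact_operator (V W : normedModType R) (f : V -> W) :=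
  linear f /\ forall S : set V, bounded_set S -> precompact (f @` S).

(* The possibly unbounded inverse of an injective operator: it is meaningful on
   range f only, and takes the value 0 elsewhere. *)
Definition op_inv (V W : normedModType R) (f : V -> W) : W -> V :=
  'pinv_(fun=> 0) [set: V] f.

Definition is_op_sqrt (Y : hilbertType R) (S T : Y -> Y) :=
  [/\ linear T, bounded_operator T,
      (forall u v, inner (T u) v = inner u (T v)),
      (forall u, 0 <= inner (T u) u) &
      T \o T = S].

(* A bounded nonnegative self-adjoint operator S has exactly one such square
   root, so op_sqrt S is S^{1/2}; the default value 0 is irrelevant for these. *)
Definition op_sqrt (Y : hilbertType R) (S : Y -> Y) : Y -> Y :=
  xget (fun=> 0) (is_op_sqrt S).

End operators.

Section random_elements.
Context {R : realType} {Y : hilbertType R}.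
Context d (Omega : measurableType d) (P : probability Omega R).
Local Open Scope ereal_scope.

Definition square_integrable_rv (eps : Omega -> Y) :=
  measurable_fun [set: Omega] (eps : Omega -> g_sigma_algebraType (@open Y)) /\
  'E_P[fun w => (`|eps w| ^+ 2)%R] < +oo.

(* m is the weak (Pettis) mean; it is the Bochner mean of a square-integrable
   random variable with values in a separable Y. *)
Definition is_mean (eps : Omega -> Y) (m : Y) :=
  forall v, 'E_P[fun w => inner (eps w) v] = (inner m v)%:E.

Definition is_centered_covariance (eps : Omega -> Y) (S : Y -> Y) :=
  [/\ square_integrable_rv eps, is_mean eps 0%R &
      forall u v, 'E_P[fun w => (inner (eps w) u * inner (eps w) v)%R] =
                  (inner (S u) v)%:E].

End random_elements.

Section ell2_def.
Context {R : realType}.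

Definition square_summable : {pred nat -> R} :=
  fun u => `[< cvgn (series (fun i => u i ^+ 2)) >].

(* Sequences are indexed from 0: ell2_basis i below is the vector usually
   written e_{i+1}. *)
Record ell2 := Ell2 { ell2_val :> nat -> R ; _ : ell2_val \in square_summable }.

HB.instance Definition _ := [isSub for ell2_val].
HB.instance Definition _ := [Choice of ell2 by <:].

Lemma square_summableP (u : nat -> R) :
  reflect (cvgn (series (fun i => u i ^+ 2))) (u \in square_summable).
Proof. exact: asboolP. Qed.

Lemma ell2P (u : ell2) : cvgn (series (fun i => u i ^+ 2)).
Proof. exact/square_summableP/(valP u). Qed.

Lemma square_summable_closed : submod_closed square_summable.
Proof.
split=> [|a u v /square_summableP us /square_summableP vs].
  apply/square_summableP; apply/cvg_ex; exists 0.
  rewrite (_ : series _ = cst 0); first exact: cvg_cst.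
  by apply/funext => n; rewrite /series/= big1// => i _; rewrite expr0n.
apply/square_summableP.
pose w := (2 * a ^+ 2) *: (fun i => u i ^+ 2) + 2 *: (fun i => v i ^+ 2).
apply: (@series_le_cvg _ _ w); rewrite /w.
- by move=> n; exact: sqr_ge0.
- move=> n; rewrite /GRing.scale/= addr_ge0// mulr_ge0 ?sqr_ge0//.
  by rewrite mulr_ge0 ?sqr_ge0.
- move=> n; rewrite -[leLHS]/((a * u n + v n) ^+ 2).
  rewrite -[leRHS]/(2 * a ^+ 2 * u n ^+ 2 + 2 * v n ^+ 2).
  by have := sqr_ge0 (a * u n - v n); rewrite -subr_ge0; lra.
- by apply: is_cvg_seriesD; exact: is_cvg_seriesZ.
Qed.

HB.instance Definition _ := GRing.isSubmodClosed.Build _ _ square_summable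
  square_summable_closed.
HB.instance Definition _ := [SubChoice_isSubLmodule of ell2 by <:].

Definition ell2_inner (u v : ell2) : R := limn (series (fun i => u i * v i)).

Lemma is_cvg_ell2_inner (u v : ell2) : cvgn (series (fun i => u i * v i)).
Proof.
apply: normed_cvg.
apply: (@series_le_cvg _ _ ((fun i => u i ^+ 2) + (fun i => v i ^+ 2))).
- by move=> n /=.
- by move=> n; rewrite addr_ge0// sqr_ge0.
- move=> n /=; rewrite -[leRHS]/(u n ^+ 2 + v n ^+ 2) normrM.
  rewrite -(real_normK (num_real (u n))) -(real_normK (num_real (v n))).
  have := sqr_ge0 (`|u n| - `|v n|); have := sqr_ge0 (`|u n| + `|v n|).
  by nra.
- by apply: is_cvg_seriesD; exact: ell2P.
Qed.

Lemma ell2_innerC u v : ell2_inner u v = ell2_inner v u.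
Proof.
by congr (limn (series _)); apply/funext => i; rewrite mulrC.
Qed.

Lemma ell2_inner_linear v : linear_for *%R (ell2_inner^~ v).
Proof.
move=> a u w; rewrite /ell2_inner.
have cu := @is_cvg_ell2_inner u v; have cw := @is_cvg_ell2_inner w v.
rewrite (_ : (fun i => _) =
    a *: (fun i => u i * v i) + (fun i => w i * v i)); last first.
  apply/funext => i.
  by rewrite -[LHS]/((a * u i + w i) * v i) mulrDl -mulrA.
by rewrite (lim_seriesD (is_cvg_seriesZ (k := a) cu) cw) (lim_seriesZ _ cu).
Qed.

Lemma ell2_inner_bilinear : bilinear_for *%R (@idfun R \; *%R) ell2_inner.
Proof.
split=> [v|u]; first exact: ell2_inner_linear.
by move=> a v w; rewrite !(ell2_innerC u) ell2_inner_linear.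
Qed.

HB.instance Definition _ := bilinear_isBilinear.Build R ell2 ell2 R
  *%R (@idfun R \; *%R) ell2_inner ell2_inner_bilinear.

Lemma ell2_inner_hermitian u v :
  ell2_inner u v = (-1) ^+ false * idfun (ell2_inner v u).
Proof. by rewrite expr0 mul1r ell2_innerC. Qed.

HB.instance Definition _ := isHermitianSesquilinear.Build R ell2 false idfun
  ell2_inner ell2_inner_hermitian.

Lemma ell2_partial_le (u : ell2) n :
  \sum_(0 <= i < n) u i ^+ 2 <= ell2_inner u u.
Proof.
rewrite /ell2_inner (_ : (fun i => _) = (fun i => u i ^+ 2)); last first.
  by apply/funext => i; rewrite expr2.
have nd : nondecreasing_seq (series (fun i => u i ^+ 2)).
  by apply: nondecreasing_series => i _ _; exact: sqr_ge0.
exact: (nondecreasing_cvgn_le nd (@ell2P u) n).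
Qed.

Lemma ell2_inner_gt0 u : u != 0 -> 0 < ell2_inner u u.
Proof.
move=> u0; have [i ui] : exists i, u i != 0.
  apply: contrapT => /forallNP u0'; move/eqP: u0; apply; apply/val_inj.
  by apply/funext => i; have /negP/negPn/eqP := u0' i.
apply: lt_le_trans (ell2_partial_le u i.+1); rewrite big_nat_recr//=.
rewrite ltr_wpDl ?exprn_even_gt0//.
by apply: sumr_ge0 => j _; exact: sqr_ge0.
Qed.

HB.instance Definition _ := isDotProduct.Build R ell2
  ell2_inner ell2_inner_gt0.

Definition ell2_norm u := Num.sqrt (ell2_inner u u).

Lemma ell2_inner_ge0 u : 0 <= ell2_inner u u.
Proof. by have := ell2_partial_le u 0; rewrite big_geq. Qed.

Lemma ell2_normK u : ell2_norm u ^+ 2 = ell2_inner u u.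
Proof. by rewrite sqr_sqrtr// ell2_inner_ge0. Qed.

Lemma ell2_inner_expand a b u v : ell2_inner (a *: u + b *: v) (a *: u + b *: v) =
  a ^+ 2 * ell2_inner u u + 2 * a * b * ell2_inner u v
  + b ^+ 2 * ell2_inner v v.
Proof.
have lin := ell2_inner_linear; have linr w : linear_for *%R (ell2_inner w).
  by move=> c x y; rewrite !(ell2_innerC w) lin.
have s0 w : ell2_inner w 0 = 0.
  by have := linr w (-1) 0 0; rewrite scaler0 addr0 mulN1r addNr.
have sr w c x : ell2_inner w (c *: x) = c * ell2_inner w x.
  by rewrite -[c *: x]addr0 linr s0 addr0.
have sl c x w : ell2_inner (c *: x) w = c * ell2_inner x w.
  by rewrite ell2_innerC sr ell2_innerC.
by rewrite lin !linr !sr !sl (ell2_innerC v u); ring.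
Qed.

Lemma ell2_cauchy_schwarz u v : `|ell2_inner u v| <= ell2_norm u * ell2_norm v.
Proof.
set p := ell2_inner u v.
have nu : 0 <= ell2_norm u by exact: sqrtr_ge0.
have nv : 0 <= ell2_norm v by exact: sqrtr_ge0.
rewrite -ler_sqr ?nnegrE ?mulr_ge0// real_normK ?num_real//.
rewrite exprMn !ell2_normK.
have := ell2_inner_ge0 (ell2_inner v v *: u + (- p) *: v).
rewrite ell2_inner_expand -/p => h.
have := ell2_inner_ge0 v; rewrite le_eqVlt => /predU1P[v0|v0]; last first.
  by rewrite -(ler_pM2l v0); nra.
have -> : p = 0.
  apply/eqP/negPn/negP => p0.
  have := ell2_inner_ge0 (p *: u + (- (1 + ell2_inner u u)) *: v).
  rewrite ell2_inner_expand -/p -v0.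
  have : 0 < p ^+ 2 by rewrite exprn_even_gt0.
  by have := ell2_inner_ge0 u; nra.
by rewrite expr0n mulr_ge0 ?ell2_inner_ge0.
Qed.

Lemma ell2_normD u v : ell2_norm (u + v) <= ell2_norm u + ell2_norm v.
Proof.
have nu : 0 <= ell2_norm u by exact: sqrtr_ge0.
have nv : 0 <= ell2_norm v by exact: sqrtr_ge0.
rewrite -ler_sqr ?nnegrE ?addr_ge0 ?sqrtr_ge0// sqrrD !ell2_normK.
have := ell2_inner_expand 1 1 u v; rewrite !scale1r => ->.
have := le_trans (ler_norm _) (ell2_cauchy_schwarz u v); nra.
Qed.

Lemma ell2_normZ a u : ell2_norm (a *: u) = `|a| * ell2_norm u.
Proof.
have := ell2_inner_expand a 0 u 0; rewrite scale0r addr0 => auE.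
rewrite /ell2_norm auE mulr0 mul0r expr0n mul0r !addr0.
by rewrite sqrtrM ?sqr_ge0// sqrtr_sqr.
Qed.

Lemma ell2_norm0_eq0 u : ell2_norm u = 0 -> u = 0.
Proof.
move=> u0; apply/eqP/negPn/negP => /ell2_inner_gt0.
by rewrite -ell2_normK u0 expr0n ltxx.
Qed.

HB.instance Definition _ := Lmodule_isNormed.Build R ell2
  ell2_normD ell2_normZ ell2_norm0_eq0.

Lemma ell2_normE (u : ell2) : `|u| = ell2_norm u. Proof. by []. Qed.

Lemma ell2_coord_le (u : ell2) i : `|u i| <= `|u|.
Proof.
rewrite -ler_sqr ?nnegrE// ell2_normE ell2_normK real_normK ?num_real//.
apply: le_trans (ell2_partial_le u i.+1); rewrite big_nat_recr//= ler_wpDl//.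
by apply: sumr_ge0 => j _; exact: sqr_ge0.
Qed.

Lemma ell2_complete (F : set_system ell2) : ProperFilter F -> cauchy F -> cvg F.
Proof.
move=> FF /cauchy_ballP Fc.
have coordB (u v : ell2) i : (u - v) i = u i - v i by [].
have cvgi i : cvg ((fun u : ell2 => u i) @ F).
  apply/cauchy_cvgP/cauchy_ballP => e e0; near_simpl.
  apply: filterS (Fc e e0) => -[u v] /=; rewrite -!ball_normE/= => uv.
  by rewrite -coordB (le_lt_trans _ uv)// ell2_coord_le.
pose w i := lim ((fun u : ell2 => u i) @ F).
have bound e : 0 < e -> \forall u \near F,
    forall n, \sum_(0 <= i < n) ((u : ell2) i - w i) ^+ 2 <= e ^+ 2.
  move=> e0; have [Q [Q1 Q2] Qe] := Fc e e0.
  apply: filterS Q1 => u Qu n.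
  have cs : (fun v : ell2 => \sum_(0 <= i < n) (u i - v i) ^+ 2) @ F -->
      \sum_(0 <= i < n) (u i - w i) ^+ 2.
    apply: (cvg_big (op := +%R)) => [|i _]; first exact: add_continuous.
    rewrite expr2.
    under eq_fun do rewrite expr2.
    by apply: cvgM; (apply: cvgB; [exact: cvg_cst|exact: cvgi]).
  rewrite -(cvg_lim _ cs)//; apply: limr_le; first exact: cvgP cs.
  apply: filterS Q2 => v Qv /=.
  have := Qe (u, v) (conj Qu Qv); rewrite /= -ball_normE/= => uv.
  apply: (le_trans (ell2_partial_le (u - v) n)).
  by rewrite -ell2_normK ler_sqr ?nnegrE ?sqrtr_ge0 ?(ltW e0)//; exact: ltW uv.
have dP (u : ell2) e : (forall n, \sum_(0 <= i < n) (u i - w i) ^+ 2 <= e ^+ 2) ->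
    (fun i => u i - w i) \in square_summable.
  move=> ub; apply/square_summableP/nondecreasing_is_cvgn.
    by apply: nondecreasing_series => i _ _; exact: sqr_ge0.
  by exists (e ^+ 2) => _ [n _ <-]; exact: ub.
have [u0 u0b] := filter_ex (bound 1 ltr01).
have wP : w \in square_summable.
  rewrite (_ : w = ell2_val (u0 - Ell2 (dP _ _ u0b))); first exact: valP.
  by apply/funext => i; rewrite coordB/= subKr.
apply/cvg_ex; exists (Ell2 wP); apply/cvgrPdist_le => /= e e0.
apply: filterS (bound e e0) => u ub.
rewrite distrC -ler_sqr ?nnegrE ?(ltW e0)// ell2_normE ell2_normK.
apply: limr_le; first exact: is_cvg_ell2_inner.
apply: nearW => n; apply: le_trans (ub n); rewrite /series/=.
by apply: ler_sum => i _; rewrite -[leLHS]/((u i - w i) * (u i - w i)) expr2.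
Qed.

HB.instance Definition _ := Uniform_isComplete.Build ell2 ell2_complete.

Lemma ell2_inner_norm u : ell2_inner u u = `|u| ^+ 2.
Proof. by rewrite ell2_normE ell2_normK. Qed.

HB.instance Definition _ := CompleteNormedModule_isHilbert.Build R ell2
  ell2_inner_norm.

Lemma ell2_basis_subproof (i : nat) :
  (fun j => (j == i)%:R : R) \in square_summable.
Proof.
apply/square_summableP/cvg_ex; exists 1.
apply: cvg_near_cst; exists i.+1 => // n /= ni.
rewrite /series/= (bigD1_seq i) ?mem_index_iota ?iota_uniq//= eqxx expr1n.
by rewrite big1 ?addr0// => j /negPf ->; rewrite expr0n.
Qed.

Definition ell2_basis (i : nat) : ell2 := Ell2 (ell2_basis_subproof i).

Definition ell2_span (I : {fset nat}) : set ell2 :=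
  [set u | exists c : nat -> R, u = \sum_(i <- I) c i *: ell2_basis i].

Local Open Scope ereal_scope.
(* The ell^1 norm, equal to +oo exactly when u is not summable. *)
Definition ell1_norm (u : ell2) : \bar R := \sum_(0 <= i <oo) `|u i|%:E.

End ell2_def.
Arguments ell2 : clear implicits.

Section l1_regularization.
Context {R : realType} {X Y : hilbertType R}.

(* Sigma^{-1} A is compact; in particular it is required to be linear, which
   holds as soon as Sigma and A are linear and Sigma is injective. *)
Definition compatible (Sigma : Y -> Y) (A : X -> Y) :=
  range A `<=` range Sigma /\ compact_operator (op_inv Sigma \o A).

Definition finite_basis_injective (T : ell2 R -> Y) :=
  forall I : {fset nat}, {in ell2_span I &, injective T}.

Definition tikhonov_l1 (Sigma : Y -> Y) (A : X -> Y) (B : ell2 R -> X) (y : Y)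
    (u : ell2 R) : \bar R :=
  ((2^-1 * `|op_inv (op_sqrt Sigma) (A (B u))| ^+ 2
    - inner y (op_inv Sigma (A (B u))))%R%:E + ell1_norm u)%E.

End l1_regularization.

Definition minimizer {R : realType} {T : Type} (f : T -> \bar R) (u : T) :=
  forall v, (f u <= f v)%E.

(* Main.v *)
(* Write K = Sigma^-1 A B, which is compact, and T = Sigma^(1/2), so that
   J(u) = |T K u|^2 / 2 - <y, K u> + |u|_1.  Compactness of K and injectivity of
   T give |<y, K w>| <= |w| / 2 + c |T K w| for some c, whence |T K u| <= 2 c
   and |u|_1 <= c^2 on the sublevel set J <= 0.  Since K e_i -> 0, there is an N
   such that the derivative of the smooth part of J in the direction e_i is
   smaller than 1/2 in absolute value for every i > N and every such u.  A
   minimizer u of J over the span of e_0, ..., e_N therefore satisfies all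
   coordinatewise optimality conditions, and by convexity it is a global
   minimizer: for every j,
     J(v) - J(u) >= |T K (v - u)|^2 / 2
                    + ((v_j - u_j) dF(u)(e_j) + |v_j| - |u_j|),
   where F is the smooth part of J and the bracket is nonnegative.
   If v is another minimizer, the right-hand side vanishes: the bracket for
   j > N gives v_j = 0, and T K v = T K u gives v = u by finite basis
   injectivity.
   The square root of Sigma is I - L up to scaling, where L is the limit of the
   iteration L_(n+1) = (C + L_n^2) / 2 and C = I - Sigma up to scaling. *)
From HB Require Import structures.
Require Import Defs.
From mathcomp Require Import all_boot all_order all_algebra finmap.
From mathcomp Require Import all_classical all_reals all_analysis.
From mathcomp Require Import ring lra.
Import Order.TTheory GRing.Theory Num.Theory.
Import numFieldNormedType.Exports.
Local Open Scope classical_set_scope.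
Local Open Scope ring_scope.

(** * Inner products: Cauchy-Schwarz and continuity *)

Section inner_product.
Context {R : realType} {V : hilbertType R}.
Implicit Types (u v w : V) (a : R).

Lemma innerC u v : inner u v = inner v u.
Proof. by rewrite hermC expr0 mul1r. Qed.

Lemma innerDl u v w : inner (u + v) w = inner u w + inner v w.
Proof. exact: linearDl. Qed.

Lemma innerDr w u v : inner w (u + v) = inner w u + inner w v.
Proof. exact: linearDr. Qed.

Lemma innerBl u v w : inner (u - v) w = inner u w - inner v w.
Proof. exact: linearBl. Qed.

Lemma innerBr w u v : inner w (u - v) = inner w u - inner w v.
Proof. exact: linearBr. Qed.

Lemma innerZl a u v : inner (a *: u) v = a * inner u v.
Proof. exact: linearZl_LR. Qed.

Lemma innerZr a u v : inner u (a *: v) = a * inner u v.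
Proof. by rewrite innerC innerZl innerC. Qed.

Lemma inner0l u : inner 0 u = 0.
Proof. exact: linear0l. Qed.

Lemma inner0r u : inner u 0 = 0.
Proof. exact: linear0r. Qed.

Definition innerE := (innerBl, innerBr, innerDl, innerDr, innerZl, innerZr).

Lemma normD_sqr u v : `|u + v| ^+ 2 = `|u| ^+ 2 + 2 * inner u v + `|v| ^+ 2.
Proof. by rewrite -!inner_norm !innerE (innerC v u); ring. Qed.

Lemma inner_le u v : inner u v <= `|u| * `|v|.
Proof.
have [->|u0] := eqVneq u 0.
  by rewrite normr0 mul0r inner0l.
have [->|v0] := eqVneq v 0.
  by rewrite normr0 mulr0 inner0r.
have nu : 0 < `|u| by rewrite normr_gt0.
have nv : 0 < `|v| by rewrite normr_gt0.
(* Expanding this square gives 2|u||v|(|u||v| - <u,v>) >= 0. *)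
have := sqr_ge0 `| (`|v|) *: u - `|u| *: v |.
rewrite -inner_norm !innerE !inner_norm (innerC v u) => h.
have : 0 <= (2 * `|u| * `|v|) * (`|u| * `|v| - inner u v).
  by apply: le_trans h _; rewrite le_eqVlt; apply/orP; left; apply/eqP; ring.
by rewrite pmulr_rge0 ?mulr_gt0// subr_ge0.
Qed.

Lemma cauchy_schwarz u v : `|inner u v| <= `|u| * `|v|.
Proof.
rewrite ler_norml inner_le andbT lerNl -(normrN u).
by apply: le_trans (inner_le (- u) v); rewrite -(scaleN1r u) innerZl mulN1r.
Qed.

Lemma cvg_inner (T : Type) (F : set_system T) {FF : Filter F}
    (f g : T -> V) u v :
  f @ F --> u -> g @ F --> v -> (fun t => inner (f t) (g t)) @ F --> inner u v.
Proof.
move=> fu gv; rewrite -[inner u v]addr0 -[X in _ + X]addr0.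
(* Each of the two error terms pairs a vector tending to 0 with a convergent one, so Cauchy-Schwarz
   sends it to 0. *)
rewrite (_ : (fun _ => _) = (fun t =>
  inner u v + ((inner (f t - u) v) + (inner (f t) (g t - v))))); last first.
  by apply/funext => t; rewrite !innerE; ring.
have nf : `|f t| @[t --> F] --> `|u| by exact: cvg_norm.
have n0 (h : T -> V) w : h @ F --> w -> `|h t - w| @[t --> F] --> 0.
  move=> hw; rewrite -(@normr0 _ V) -(subrr w); apply: cvg_norm.
  by apply: cvgB => //; exact: cvg_cst.
apply: cvgD; first exact: cvg_cst.
apply: cvgD.
- apply/norm_cvg0P.
  apply: (@squeeze_cvgr _ _ _ _ (fun=> 0) (fun t => `|f t - u| * `|v|)).
  + by apply: nearW => t; rewrite normr_ge0 cauchy_schwarz.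
  + exact: cvg_cst.
  + by rewrite -[0](mul0r `|v|); apply: cvgM; [exact: n0|exact: cvg_cst].
- apply/norm_cvg0P.
  apply: (@squeeze_cvgr _ _ _ _ (fun=> 0) (fun t => `|f t| * `|g t - v|)).
  + by apply: nearW => t; rewrite normr_ge0 cauchy_schwarz.
  + exact: cvg_cst.
  + by rewrite -[0](mulr0 `|u|); apply: cvgM; [|exact: n0].
Qed.

End inner_product.

(** * Square roots of nonnegative operators *)

Section square_root.
Context {R : realType} {V : hilbertType R}.

(** Nonnegativity of C at the vector |Cu| u - |u| Cu bounds the cross term 2|Cu|^3|u| by |Cu|^2
    <Cu,u> + |u|^2 <CCu,Cu>, which is at most 2|u|^2|Cu|^2. *)
Lemma nonneg_contraction (C : {linear V -> V}) :
  (forall u v, inner (C u) v = inner u (C v)) ->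
  (forall u, 0 <= inner (C u) u <= `|u| ^+ 2) ->
  forall u, `|C u| <= `|u|.
Proof.
move=> Csym Cge u; have [->|Cu0] := eqVneq (C u) 0; first by rewrite normr0.
have nCu : 0 < `|C u| by rewrite normr_gt0.
have /andP[_ Cule] := Cge u; have /andP[_ CCule] := Cge (C u).
have /andP[+ _] := Cge (`|C u| *: u - `|u| *: C u).
rewrite (linearB C) !(linearZ_LR C) /= !innerE (Csym (C u) u) inner_norm => h.
have : 0 <= `|C u| ^+ 2 * (`|u| - `|C u|) * `|u|.
  have h1 : `|C u| ^+ 2 * inner (C u) u <= `|C u| ^+ 2 * `|u| ^+ 2.
    by rewrite ler_wpM2l ?sqr_ge0.
  have h2 : `|u| ^+ 2 * inner (C (C u)) (C u) <= `|u| ^+ 2 * `|C u| ^+ 2.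
    by rewrite ler_wpM2l ?sqr_ge0.
  by lra.
have [->|u0] := eqVneq u 0; first by rewrite linear0.
have nu : 0 < `|u| by rewrite normr_gt0.
by rewrite pmulr_lge0// pmulr_rge0 ?exprn_gt0// subr_ge0.
Qed.

(** A fixed point L of this recursion satisfies 2L = C + L^2, that is (I - L)^2 = I - C. *)
Fixpoint root_iter (C : V -> V) (n : nat) : V -> V :=
  if n is m.+1 then fun x => 2^-1 *: (C x + root_iter C m (root_iter C m x))
  else fun=> 0.

(** The same recursion for the scalar C = 1; it majorizes the operator iterates of every
    contraction. *)
Fixpoint root_bound (n : nat) : R :=
  if n is m.+1 then (1 + root_bound m ^+ 2) / 2 else 0.

Lemma root_bound_itv n : 0 <= root_bound n <= 1.
Proof.
elim: n => [|n /andP[h0 h1]] /=; first by rewrite lexx ler01.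
by apply/andP; split; nra.
Qed.

Lemma root_bound_nd : nondecreasing_seq root_bound.
Proof.
apply/nondecreasing_seqP => n /=.
by have := sqr_ge0 (root_bound n - 1); lra.
Qed.

Lemma is_cvg_root_bound : cvgn root_bound.
Proof.
apply: nondecreasing_is_cvgn root_bound_nd _.
by exists 1 => _ [n _ <-]; have /andP[] := root_bound_itv n.
Qed.

Lemma root_iter_linear (C : {linear V -> V}) n : linear (root_iter C n).
Proof.
elim: n => [|n IH] a x y /=; first by rewrite scaler0 addr0.
rewrite !IH linearP scalerA mulrC -scalerA -scalerDr; congr (_ *: _).
by rewrite scalerDr addrACA.
Qed.

HB.instance Definition _ (C : {linear V -> V}) n :=
  GRing.isLinear.Build R V V _ (root_iter C n) (root_iter_linear C n).

(** The iterates are built from C by sums, scalings and compositions, all of which respect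
    commutation with a linear map. *)
Lemma root_iter_comm (C : V -> V) (K : {linear V -> V}) n :
  (forall x, K (C x) = C (K x)) ->
  forall x, K (root_iter C n x) = root_iter C n (K x).
Proof.
move=> KC; elim: n => [|n IH] x /=; first exact: linear0.
by rewrite linearZ_LR linearD KC !IH.
Qed.

Lemma root_iter_symm (C : V -> V) n :
  (forall u v, inner (C u) v = inner u (C v)) ->
  forall u v, inner (root_iter C n u) v = inner u (root_iter C n v).
Proof.
move=> Csym; elim: n => [|n IH] u v /=.
  by rewrite inner0l inner0r.
by rewrite !innerE Csym !IH.
Qed.

Section contraction.
Variable C : {linear V -> V}.
Hypothesis C_le : forall x, `|C x| <= `|x|.

Lemma root_iter_le n x : `|root_iter C n x| <= root_bound n * `|x|.
Proof.
elim: n x => [|n IH] x /=; first by rewrite normr0 mul0r.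
have /andP[t0 t1] := root_bound_itv n.
rewrite normrZ ger0_norm ?invr_ge0// mulrAC -[leLHS]mulrC ler_pM2r ?invr_gt0//.
rewrite mulrDl mul1r (le_trans (ler_normD _ _))// lerD//.
by rewrite (le_trans (IH _))// expr2 -mulrA ler_wpM2l.
Qed.

(* With [T_n = root_iter C n], the difference [D_n = T_(n+1) - T_n] satisfies
   [D_(n+1) = D_n (T_(n+1) + T_n) / 2] because
   the iterates commute, which is the recursion of the scalar differences. *)
Lemma root_iterS_sub_le n x :
  `|root_iter C n.+1 x - root_iter C n x| <=
  (root_bound n.+1 - root_bound n) * `|x|.
Proof.
elim: n x => [|n IH] x.
  rewrite /= !subr0 addr0 expr0n addr0 mul1r normrZ ger0_norm ?invr_ge0//.
  by rewrite ler_wpM2l ?invr_ge0.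
set T := root_iter C n; set T' := root_iter C n.+1.
(* C commutes with T', so T' in turn commutes with every iterate of C, in particular with T. *)
have TT' z : T' (T z) = T (T' z).
  apply: root_iter_comm => w; apply/esym.
  by apply: (root_iter_comm _ C).
have -> : root_iter C n.+2 x - T' x =
    2^-1 *: (T' (T' x + T x) - T (T' x + T x)).
  transitivity (2^-1 *: (C x + T' (T' x)) - 2^-1 *: (C x + T (T x))) => //.
  rewrite -scalerBr opprD addrACA subrr add0r; congr (_ *: _).
  have TD : {morph T : u v / u + v} by exact: linearD.
  have T'D : {morph T' : u v / u + v} by exact: linearD.
  by rewrite TD T'D TT' addrKA.
rewrite normrZ ger0_norm ?invr_ge0//.
have := IH (T' x + T x); rewrite -/T -/T' => h.
have k : `|T' x + T x| <= (root_bound n.+1 + root_bound n) * `|x|.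
  by rewrite mulrDl (le_trans (ler_normD _ _))// lerD// root_iter_le.
have d0 : 0 <= root_bound n.+1 - root_bound n.
  by rewrite subr_ge0; exact: root_bound_nd.
have := le_trans h (ler_wpM2l d0 k).
have -> : root_bound n.+2 - root_bound n.+1 =
    (root_bound n.+1 - root_bound n) * (root_bound n.+1 + root_bound n) / 2.
  by rewrite /=; field.
rewrite mulrA [X in _ -> _ <= X]mulrAC [X in _ -> _ <= X]mulrC.
by rewrite ler_pM2l ?invr_gt0.
Qed.

(** Telescoping: since [root_bound] is nondecreasing, the one-step bounds add up to the scalar
    difference. The operator iterates are thus Cauchy because the scalar ones are. *)
Lemma root_iter_sub_le m n x :
  `|root_iter C m x - root_iter C n x| <=
  `|root_bound m - root_bound n| * `|x|.
Proof.
wlog nm : m n / (n <= m)%N => [hw|].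
  by case: (leqP n m) => [|/ltnW] /hw//; rewrite distrC [X in _ <= X * _]distrC.
rewrite [X in _ <= X * _]ger0_norm ?subr_ge0; last exact: root_bound_nd.
elim: m nm => [|m IH].
  by rewrite leqn0 => /eqP ->; rewrite !subrr normr0 mul0r.
rewrite leq_eqVlt => /predU1P[->|nm]; first by rewrite !subrr normr0 mul0r.
rewrite -(subrKA (root_iter C m x)) (le_trans (ler_normD _ _))//.
rewrite -[X in _ <= X * _](subrKA (root_bound m)) mulrDl lerD//.
  exact: root_iterS_sub_le.
exact: IH.
Qed.

Lemma is_cvg_root_iter x : cvg (root_iter C n x @[n --> \oo]).
Proof.
apply/cauchy_cvgP/cauchy_ballP => e e0.
have /cauchy_cvgP/cauchy_ballP := is_cvg_root_bound.
have e'0 : 0 < e / (`|x| + 1) by rewrite divr_gt0// ltr_wpDl.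
move=> /(_ _ e'0); near_simpl; apply: filterS => -[m n] /=.
rewrite -!ball_normE /= ltr_pdivlMr ?ltr_wpDl// => mn.
apply: le_lt_trans (root_iter_sub_le m n x) (le_lt_trans _ mn).
by rewrite ler_wpM2l// ler_wpDr.
Qed.

End contraction.

End square_root.

Section square_root_limit.
Context {R : realType} {V : hilbertType R}.
Variable C : {linear V -> V}.
Hypothesis C_le : forall x, `|C x| <= `|x|.

Definition root_lim x := lim (root_iter C n x @[n --> \oo]).

Lemma cvg_root_iter x : root_iter C n x @[n --> \oo] --> root_lim x.
Proof. exact: is_cvg_root_iter. Qed.

Lemma root_lim_linear : linear root_lim.
Proof.
move=> a x y.
apply: (@cvg_lim V (@norm_hausdorff _ _) _ _ _
  (fun n => root_iter C n (a *: x + y))).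
under eq_fun do rewrite linearP.
by apply: cvgD; [apply: cvgZl_tmp|]; exact: cvg_root_iter.
Qed.

HB.instance Definition _ :=
  GRing.isLinear.Build R V V _ root_lim root_lim_linear.

Lemma root_lim_le x : `|root_lim x| <= `|x|.
Proof.
have cv : `|root_iter C n x| @[n --> \oo] --> `|root_lim x|.
  by apply: cvg_norm; exact: cvg_root_iter.
rewrite -(cvg_lim _ cv)//; apply: limr_le; first exact: cvgP cv.
apply: nearW => n; apply: le_trans (root_iter_le C C_le n x) _.
by have /andP[_] := @root_bound_itv R n; exact: ler_piMl.
Qed.

Lemma root_lim_fixpoint x : 2 *: root_lim x = C x + root_lim (root_lim x).
Proof.
have TT : root_iter C n (root_iter C n x) @[n --> \oo] -->
    root_lim (root_lim x).
  rewrite -[root_lim (root_lim x)]add0r.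
  (* Both the operator and its argument vary with n. Every iterate is a contraction, so the first
     summand is at most the distance from the iterate at x to its limit. *)
  rewrite (_ : (fun _ => _) = fun n =>
    root_iter C n (root_iter C n x - root_lim x) +
    root_iter C n (root_lim x)); last first.
    by apply/funext => n; rewrite linearB subrK.
  apply: cvgD; last exact: cvg_root_iter.
  apply/norm_cvg0P.
  apply: (@squeeze_cvgr _ _ _ _ (fun=> 0)
    (fun n => `|root_iter C n x - root_lim x|)).
  - apply: nearW => n; rewrite normr_ge0 (le_trans (root_iter_le C C_le n _))//.
    by have /andP[_] := @root_bound_itv R n; exact: ler_piMl.
  - exact: cvg_cst.
  - rewrite -(@normr0 _ V) -(subrr (root_lim x)); apply: cvg_norm.
    by apply: cvgB; [exact: cvg_root_iter|exact: cvg_cst].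
have h1 : root_iter C n.+1 x @[n --> \oo] --> root_lim x.
  by have := cvg_root_iter x; rewrite -(cvg_shiftS (fun n => root_iter C n x)).
have h2 : root_iter C n.+1 x @[n --> \oo] -->
    2^-1 *: (C x + root_lim (root_lim x)).
  by apply: cvgZl_tmp; apply: cvgD => //; exact: cvg_cst.
have h3 : root_lim x = 2^-1 *: (C x + root_lim (root_lim x)).
  by apply: (cvg_unique _ h1 h2); exact: norm_hausdorff.
by rewrite [X in 2 *: X]h3 scalerA divff ?pnatr_eq0// scale1r.
Qed.

Hypothesis C_symm : forall u v, inner (C u) v = inner u (C v).

Lemma root_lim_symm u v : inner (root_lim u) v = inner u (root_lim v).
Proof.
have h1 : inner (root_iter C n u) v @[n --> \oo] --> inner (root_lim u) v.
  by apply: cvg_inner; [exact: cvg_root_iter|exact: cvg_cst].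
have h2 : inner (root_iter C n u) v @[n --> \oo] --> inner u (root_lim v).
  under eq_fun => n do rewrite (root_iter_symm C n C_symm).
  by apply: cvg_inner; [exact: cvg_cst|exact: cvg_root_iter].
by apply: (cvg_unique _ h1 h2); exact: norm_hausdorff.
Qed.

Lemma is_op_sqrt_one_sub :
  is_op_sqrt (fun x => x - C x) (fun x => x - root_lim x).
Proof.
split.
- by move=> a x y; rewrite linearP opprD addrACA scalerBr.
- exists 2 => x; rewrite (le_trans (ler_normB _ _))//.
  by rewrite mulr_natl mulr2n lerD2l root_lim_le.
- by move=> u v; rewrite !innerE root_lim_symm.
- move=> u; rewrite !innerE inner_norm subr_ge0.
  rewrite (le_trans (inner_le _ _))// expr2.
  by rewrite ler_wpM2r// root_lim_le.
- apply/funext => x /=; rewrite linearB.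
  have -> : C x = root_lim x + root_lim x - root_lim (root_lim x).
    by rewrite -mulr2n -scaler_nat root_lim_fixpoint addrK.
  by rewrite !opprB addrACA [RHS]addrA opprD.
Qed.

End square_root_limit.

Lemma op_sqrtP {R : realType} {V : hilbertType R} (S : {linear V -> V}) :
  bounded_operator S -> (forall u v, inner (S u) v = inner u (S v)) ->
  (forall u, 0 <= inner (S u) u) -> is_op_sqrt S (op_sqrt S).
Proof.
move=> [M0 SM0] Ssym Sge.
(* [op_sqrt] is chosen by [xget], so the existence of some root suffices. *)
suff ST : exists T, is_op_sqrt S T by exact: xgetPex ST.
have [M M_gt0 SM] : exists2 M, 0 < M & forall x, `|S x| <= M * `|x|.
  exists (`|M0| + 1); first by rewrite ltr_wpDl.
  move=> x; rewrite (le_trans (SM0 x))// ler_wpM2r//.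
  by rewrite (le_trans (ler_norm _))// ler_wpDr.
(* As S lies between 0 and M, C lies between 0 and I, and S = M (I - C); the root of I - C is
   rescaled by the square root of M. *)
pose C x := x - M^-1 *: S x.
have Clin : linear C.
  move=> a x y; rewrite /C linearP scalerDr !scalerBr !scalerA (mulrC a).
  by rewrite opprD addrACA.
pose CL : {linear V -> V} := HB.pack C (GRing.isLinear.Build R V V _ C Clin).
have Csym u v : inner (CL u) v = inner u (CL v).
  by rewrite /= /C !innerE Ssym.
have C_le : forall x, `|CL x| <= `|x|.
  apply: nonneg_contraction => // u.
  rewrite /= /C !innerE inner_norm subr_ge0 gerBl ler_pdivrMl//.
  rewrite mulr_ge0 ?invr_ge0 ?(ltW M_gt0)// andbT.
  by rewrite (le_trans (inner_le _ _))// expr2 mulrA ler_wpM2r.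
have [T [Tlin [b Tb] Tsym Tge TT]] : exists T, is_op_sqrt (fun x => x - CL x) T.
  by eexists; exact: is_op_sqrt_one_sub.
have s0 : 0 <= Num.sqrt M by exact: sqrtr_ge0.
exists (fun x => Num.sqrt M *: T x); split.
- by move=> a x y; rewrite Tlin scalerDr !scalerA (mulrC a).
- exists (Num.sqrt M * b) => x.
  by rewrite normrZ (ger0_norm s0) -mulrA ler_wpM2l ?Tb.
- by move=> u v; rewrite !innerE Tsym.
- by move=> u; rewrite innerZl mulr_ge0.
- apply/funext => x /=.
  pose TL : {linear V -> V} := HB.pack T (GRing.isLinear.Build R V V _ T Tlin).
  rewrite -[T (_ *: _)]/(TL _) linearZ_LR scalerA -expr2.
  rewrite sqr_sqrtr ?(ltW M_gt0)//.
  have /= -> := congr1 (@^~ x) TT.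
  by rewrite /C opprB addrC subrK scalerA divff ?gt_eqF// scale1r.
Qed.

(** * The space l^2 *)

Section ell2_theory.
Context {R : realType}.
Implicit Types (u v : ell2 R) (c : nat -> R).

(** Applied to the coordinates of a vector of l^2, this is its truncation to the first n of them. *)
Definition ell2_fin (n : nat) c : ell2 R :=
  \sum_(0 <= i < n) c i *: ell2_basis i.

Lemma ell2_fin_coord n c j : ell2_fin n c j = if (j < n)%N then c j else 0.
Proof.
rewrite /ell2_fin (big_morph (fun u : ell2 R => u j) (id1 := 0) (op1 := +%R))//.
rewrite -[LHS]/(\sum_(0 <= i < n) (c i * (j == i)%:R)).
case: ltnP => jn.
  rewrite (bigD1_seq j) ?mem_index_iota ?iota_uniq//= eqxx mulr1.
  by rewrite big1 ?addr0// => i /negPf; rewrite eq_sym => ->; rewrite mulr0.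
rewrite big_nat big1// => i /andP[_ lin].
by rewrite gtn_eqF ?mulr0// (leq_trans lin).
Qed.

Lemma ell2_fin_shift n c i a : (i < n)%N ->
  ell2_fin n (fun j => c j + a * (j == i)%:R) =
  ell2_fin n c + a *: ell2_basis i.
Proof.
move=> lin; rewrite /ell2_fin; under eq_bigr do rewrite scalerDl.
rewrite big_split /=; congr (_ + _).
rewrite (bigD1_seq i) ?mem_index_iota ?iota_uniq//= eqxx mulr1.
by rewrite big1 ?addr0// => j /negPf ->; rewrite mulr0 scale0r.
Qed.

Lemma ell2_inner_basis i v : ell2_inner (ell2_basis i) v = v i.
Proof.
rewrite /ell2_inner; apply: cvg_lim => //; apply: cvg_near_cst.
exists i.+1 => // n /= ni; rewrite /series/=.
rewrite (bigD1_seq i) ?mem_index_iota ?iota_uniq//= eqxx mul1r.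
by rewrite big1 ?addr0// => j /negPf ->; rewrite mul0r.
Qed.

Lemma ell2_inner_fin n c v :
  ell2_inner (ell2_fin n c) v = \sum_(0 <= i < n) c i * v i.
Proof.
rewrite /ell2_fin linear_sumlz; apply: eq_bigr => i _.
by rewrite linearZl_LR; congr (_ * _); exact: ell2_inner_basis.
Qed.

Lemma ell2_norm_fin n c : `|ell2_fin n c| ^+ 2 = \sum_(0 <= i < n) c i ^+ 2.
Proof.
rewrite -ell2_inner_norm ell2_inner_fin; apply: eq_big_nat => i /andP[_ lin].
by rewrite ell2_fin_coord lin expr2.
Qed.

Lemma ell2_norm_basis i : `|ell2_basis i : ell2 R| = 1.
Proof.
apply/eqP; rewrite -(@eqrXn2 _ 2)// -ell2_inner_norm ell2_inner_basis /=.
by rewrite eqxx expr1n.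
Qed.

Lemma cvg_ell2_fin u : ell2_fin n u @[n --> \oo] --> u.
Proof.
have cs := @is_cvg_ell2_inner _ u u.
have c0 : ell2_inner u u - series (fun i => u i * u i) n @[n --> \oo] --> 0.
  rewrite -(subrr (ell2_inner u u)); apply: cvgB; first exact: cvg_cst.
  exact: cs.
(* Pythagoras: the squared error is the tail of the series of squares. *)
have h n : `|u - ell2_fin n u| ^+ 2 =
    ell2_inner u u - series (fun i => u i * u i) n.
  rewrite -ell2_inner_norm linearBl !linearBr /= (ell2_innerC u (ell2_fin n u)).
  rewrite (ell2_inner_norm (ell2_fin n u)) ell2_norm_fin ell2_inner_fin.
  by under [X in _ - (_ - X)]eq_bigr do rewrite expr2; rewrite subrr subr0.
have c1 : `|u - ell2_fin n u| @[n --> \oo] --> 0.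
  rewrite -(sqrtr0 R) (_ : (fun _ => _) = fun n =>
      Num.sqrt (ell2_inner u u - series (fun i => u i * u i) n)).
    by apply: (continuous_cvg _ _ c0); exact: sqrt_continuous.
  by apply/funext => n; rewrite -h sqrtr_sqr normr_id.
by apply/cvgrPdist_lt => e e0; have /cvgrPdist_lt/(_ e e0) := c1;
  apply: filterS => n; rewrite sub0r normrN normr_id.
Qed.

(** The values f(e_i) are square summable: testing f on w, the sum of f(e_i) e_i over i < n, gives
    |w|^2 = f(w) <= M |w|, so the partial sums of squares stay below M^2. *)
Lemma ell2_functional_basis (f : {linear ell2 R -> R^o}) :
  bounded_operator f -> f (ell2_basis i) @[i --> \oo] --> (0 : R).
Proof.
move=> [M fM].
have bnd n : \sum_(0 <= i < n) f (ell2_basis i) ^+ 2 <= M ^+ 2.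
  set S := \sum_(0 <= i < n) _.
  have S0 : 0 <= S by apply: sumr_ge0 => i _; exact: sqr_ge0.
  pose w := ell2_fin n (fun i => f (ell2_basis i)).
  have fw : f w = S.
    rewrite /w /ell2_fin linear_sum; apply: eq_bigr => i _.
    by rewrite linearZ_LR expr2.
  have nw : `|w| ^+ 2 = S by exact: ell2_norm_fin.
  have := fM w; rewrite fw (ger0_norm S0) -nw expr2 => h.
  have w0 : 0 <= `|w| by [].
  have [w00|w00] := eqVneq `|w| 0; first by rewrite w00 mul0r sqr_ge0.
  have wp : 0 < `|w| by rewrite lt_neqAle eq_sym w00.
  have hw : `|w| <= M by rewrite -(ler_pM2r wp).
  by rewrite expr2 ler_pM.
have /cvg_series_cvg_0 : cvgn (series (fun i => f (ell2_basis i) ^+ 2 : R)).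
  apply: nondecreasing_is_cvgn.
    by apply: nondecreasing_series => i _ _; exact: sqr_ge0.
  by exists (M ^+ 2) => _ [n _ <-]; exact: bnd.
move=> h; apply/norm_cvg0P.
rewrite -(sqrtr0 R); under eq_fun => n do rewrite -sqrtr_sqr.
by apply: (continuous_cvg _ _ h); exact: sqrt_continuous.
Qed.

Lemma ell1_norm_ge0 u : (0 <= ell1_norm u)%E.
Proof. by apply: nneseries_ge0 => n _ _; rewrite lee_fin. Qed.

Lemma ell1_norm_cvg u (m : R) : ell1_norm u = m%:E ->
  \sum_(0 <= i < n) `|u i| @[n --> \oo] --> m.
Proof.
move=> um.
have h : \sum_(0 <= i < n) `|u i|%:E @[n --> \oo] --> m%:E.
  by rewrite -um; apply: is_cvg_nneseries => i _ _; rewrite lee_fin.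
rewrite (_ : (fun _ => _) = fine \o (fun n => \sum_(0 <= i < n) `|u i|%:E)%E).
  exact: fine_cvg h.
by apply/funext => n /=; rewrite sumEFin.
Qed.

Lemma ell1_norm_partial u (m : R) n : ell1_norm u = m%:E ->
  \sum_(0 <= i < n) `|u i| <= m.
Proof.
move=> um; rewrite -lee_fin -um -sumEFin.
by apply: nneseries_lim_ge => i _; rewrite lee_fin.
Qed.

Lemma ell2_norm_le_ell1 u (m : R) : ell1_norm u = m%:E -> `|u| <= m.
Proof.
move=> um.
have h : `|ell2_fin n u| @[n --> \oo] --> `|u|.
  by apply: cvg_norm; exact: cvg_ell2_fin.
rewrite -(cvg_lim _ h)//; apply: limr_le; first exact: cvgP h.
apply: nearW => n; apply: le_trans (ell1_norm_partial _ _ n um).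
rewrite (le_trans (ler_norm_sum _ _ _))//; apply: ler_sum => i _.
by rewrite normrZ ell2_norm_basis mulr1.
Qed.

Lemma ell1_norm_fin n c :
  ell1_norm (ell2_fin n c) = (\sum_(0 <= i < n) `|c i|)%:E.
Proof.
rewrite /ell1_norm (nneseries_split 0 n); last by move=> i _; rewrite lee_fin.
rewrite add0n [X in (_ + X)%E]eseries0 ?adde0; last first.
  move=> i /= ni _; rewrite ell2_fin_coord ltnNge ni /= normr0//.
rewrite sumEFin; congr (_%:E); apply: eq_big_nat => i /andP[_ lin].
by rewrite ell2_fin_coord lin.
Qed.

End ell2_theory.

(** * Compact operators *)

Section compact_operators.
Context {R : realType}.

Lemma compact_operator_unit_ball {V W : normedModType R} (K : V -> W) :
  compact_operator K -> compact (closure (K @` [set w | `|w| <= 1])).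
Proof.
move=> [_ Kc]; rewrite -precompactE; apply: Kc.
by exists 1; split=> // r r1 x /= /le_trans; apply; exact: ltW.
Qed.

Lemma normalized_in_ball {V W : normedModType R} (K : {linear V -> W}) x :
  x != 0 -> closure (K @` [set w | `|w| <= 1]) (`|x|^-1 *: K x).
Proof.
rewrite -normr_gt0 => x0; apply: subset_closure.
exists (`|x|^-1 *: x); last by rewrite linearZ_LR.
by rewrite /= normrZ ger0_norm ?invr_ge0// mulVf ?gt_eqF.
Qed.

Lemma compact_operator_bounded {V W : normedModType R} (K : {linear V -> W}) :
  compact_operator K -> bounded_operator K.
Proof.
move=> /compact_operator_unit_ball /compact_bounded [M [_ KM]].
exists (`|M| + 1) => x; have [->|x0] := eqVneq x 0.
  by rewrite linear0 !normr0 mulr0.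
have nx : 0 < `|x| by rewrite normr_gt0.
have M1 : M < `|M| + 1 by rewrite (le_lt_trans (ler_norm M))// ltrDl.
have /= := KM _ M1 _ (normalized_in_ball K x x0).
by rewrite normrZ ger0_norm ?invr_ge0// ler_pdivrMl// mulrC.
Qed.

(** On the compact closure of the image of the unit ball, each z is either 0 or has T z nonzero, so
    |<y,z>| < eta + n |T z| for some n. This is an open condition, monotone in n, so compactness
    gives a single n; homogeneity extends it to all w. *)
Lemma compact_operator_inner_le {V : normedModType R} {Y : hilbertType R}
    (K : {linear V -> Y}) (T : {linear Y -> Y}) (y : Y) (eta : R) :
  compact_operator K -> bounded_operator T -> injective T -> 0 < eta ->
  exists2 c, 0 <= c &
    forall w, `|inner y (K w)| <= eta * `|w| + c * `|T (K w)|.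
Proof.
move=> Kc /bounded_operatorP Tc Tinj eta0.
have /compact_near_coveringP Kcov := compact_operator_unit_ball _ Kc.
have [|n _ Hn] := Kcov nat \oo
    (fun n z => `|inner y z| < eta + n%:R * `|T z|).
  move=> z _.
  have [n0 hn0] : exists n0 : nat, `|inner y z| < eta + n0%:R * `|T z|.
    have [->|z0] := eqVneq z 0.
      by exists 0%N; rewrite inner0r normr0 mul0r addr0.
    have Tz : 0 < `|T z|.
      by rewrite normr_gt0 -(linear0 T); apply: contra_neq z0; exact: Tinj.
    exists (Num.truncn (`|inner y z| / `|T z|)).+1.
    have := truncnS_gt (`|inner y z| / `|T z|).
    by rewrite ltr_pdivrMr// => /lt_le_trans; apply; rewrite lerDr ltW.
  have h : (fun z' => eta + n0%:R * `|T z'| - `|inner y z'|) z' @[z' --> z] -->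
      eta + n0%:R * `|T z| - `|inner y z|.
    apply: cvgB.
      apply: cvgD; first exact: cvg_cst.
      by apply: cvgM; [exact: cvg_cst|apply: cvg_norm; exact: Tc].
    by apply: cvg_norm; apply: cvg_inner; [exact: cvg_cst|exact: cvg_id].
  have hz : \forall z' \near z, 0 < eta + n0%:R * `|T z'| - `|inner y z'|.
    by apply: (cvgr_gt _ h); rewrite subr_gt0.
  exists ([set z' | 0 < eta + n0%:R * `|T z'| - `|inner y z'|],
          [set n | (n0 <= n)%N]).
    by split=> //; exists n0.
  move=> [z' n] [/= + n0n]; rewrite subr_gt0 => /lt_le_trans; apply.
  by rewrite lerD2l ler_wpM2r// ler_nat.
exists n%:R => // w; have [->|w0] := eqVneq w 0.
  by rewrite !linear0 !normr0 !mulr0 addr0.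
have nw : 0 < `|w| by rewrite normr_gt0.
have /= := Hn n (leqnn n) _ (normalized_in_ball K w w0).
rewrite innerZr (linearZ_LR T) normrM normrZ ger0_norm ?invr_ge0// => /ltW.
rewrite ler_pdivrMl// => /le_trans; apply.
by rewrite mulrDr (mulrC _ eta) mulrCA mulVKf ?gt_eqF.
Qed.

(** K e_i tends weakly to 0, and all K e_i lie in a compact set. Near each point of that set, no K
    e_i with i large has norm at least e; compactness makes the threshold on i uniform. *)
Lemma compact_operator_basis {Y : hilbertType R} (K : {linear ell2 R -> Y}) :
  compact_operator K -> `|K (ell2_basis i)| @[i --> \oo] --> (0 : R).
Proof.
move=> Kc; have [M KM] := compact_operator_bounded _ Kc.
have /compact_near_coveringP Kcov := compact_operator_unit_ball _ Kc.
have weak z : inner z (K (ell2_basis i)) @[i --> \oo] --> (0 : R).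
  have flin : linear (fun u => inner z (K u) : R^o).
    by move=> a u v; rewrite linearP !innerE.
  pose f : {linear ell2 R -> R^o} := HB.pack (fun u => inner z (K u) : R^o)
    (GRing.isLinear.Build R (ell2 R) R^o _ _ flin).
  apply: (ell2_functional_basis f).
  exists (`|z| * M) => u; rewrite (le_trans (cauchy_schwarz _ _))//.
  by rewrite -mulrA ler_wpM2l.
apply/cvgrPdist_lt => e e0.
have : \forall i \near \oo, closure (K @` [set w | `|w| <= 1]) `<=`
    (fun z => K (ell2_basis i) = z -> `|z| < e).
  apply: Kcov => z _.
  have [ze|ze] := ltP `|z| (e / 2).
    exists (ball z (e / 2), setT); first split.
    - by apply: nbhsx_ballx; lra.
    - exact: filterT.
    move=> [z' i] [/= + _ _]; rewrite -ball_normE /= => zz'.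
    rewrite -(subrK z z') (le_lt_trans (ler_normD _ _))// distrC; lra.
  have nz : 0 < `|z| by lra.
  (* If K e_i were this close to z, then <z, K e_i> would exceed |z|^2 / 2, against weak
     convergence. *)
  exists (ball z (`|z| / 2),
          [set i | `|inner z (K (ell2_basis i))| < `|z| ^+ 2 / 2]).
    split; first by apply: nbhsx_ballx; lra.
    have /cvgrPdist_lt/(_ (`|z| ^+ 2 / 2)) := weak z.
    move=> /(_ ltac:(by rewrite divr_gt0 ?exprn_gt0)).
    by apply: filterS => i; rewrite sub0r normrN.
  move=> [z' i] [/= + + z'E]; rewrite z'E -ball_normE /= => zz' zi; exfalso.
  have := cauchy_schwarz z (z - z'); rewrite innerBr inner_norm => h.
  have h1 := le_trans (ler_norm _) h.
  have h2 := ler_norm (inner z z').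
  have : `|z| * `|z - z'| < `|z| * (`|z| / 2) by rewrite ltr_pM2l.
  by rewrite expr2 in h1 zi; nra.
apply: filterS => i Hi; rewrite sub0r normrN normr_id; apply: Hi => //.
by apply: subset_closure; exists (ell2_basis i) => //=; rewrite ell2_norm_basis.
Qed.

End compact_operators.

(** * Minimization *)

Section l1_minimization.
Context {R : realType} {Y : hilbertType R}.
Variables (K : {linear ell2 R -> Y}) (T : {linear Y -> Y}) (y : Y).

Definition quad (u : ell2 R) : R := 2^-1 * `|T (K u)| ^+ 2 - inner y (K u).

(** The derivative of [quad] at [u] in the direction [h]. *)
Definition quad_diff (u h : ell2 R) : R :=
  inner (T (K u)) (T (K h)) - inner y (K h).

(** The functional J on the span of the first n basis vectors, in coordinates and real-valued. *)
Definition fin_energy (n : nat) (c : nat -> R) : R :=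
  quad (ell2_fin n c) + \sum_(0 <= i < n) `|c i|.

(** The second-order expansion of a quadratic function is exact; its remainder later forces
    uniqueness. *)
Lemma quad_expand u v :
  quad v = quad u + quad_diff u (v - u) + 2^-1 * `|T (K (v - u))| ^+ 2.
Proof.
rewrite -{1}(subrK u v) (addrC _ u); move: (v - u) => h.
by rewrite /quad /quad_diff (linearD K) (linearD T) normD_sqr innerDr; field.
Qed.

Lemma quad_diffZ u a h : quad_diff u (a *: h) = a * quad_diff u h.
Proof.
by rewrite /quad_diff (linearZ_LR K) (linearZ_LR T) /= !innerZr mulrBr.
Qed.

Lemma quad_diff_fin u n c :
  quad_diff u (ell2_fin n c) =
  \sum_(0 <= i < n) c i * quad_diff u (ell2_basis i).
Proof.
rewrite /quad_diff /ell2_fin (linear_sum K) (linear_sum T) /=.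
rewrite !linear_sumr -sumrB.
apply: eq_bigr => i _.
by rewrite (linearZ_LR K) (linearZ_LR T) /= !innerZr mulrBr.
Qed.

Lemma fin_energy0 n : fin_energy n (fun=> 0) = 0.
Proof.
rewrite /fin_energy big1 ?addr0//; last by move=> i _; rewrite normr0.
rewrite /quad /ell2_fin big1; last by move=> i _; rewrite scale0r.
by rewrite (linear0 K) (linear0 T) inner0r normr0 expr0n mulr0 subr0.
Qed.

Hypothesis K_bounded : bounded_operator K.
Hypothesis T_bounded : bounded_operator T.

Let K_cont : continuous K := (bounded_operatorP K).1 K_bounded.
Let T_cont : continuous T := (bounded_operatorP T).1 T_bounded.

Lemma cvg_quad_diff u (h : ell2 R) :
  quad_diff u (ell2_fin n h) @[n --> \oo] --> quad_diff u h.
Proof.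
have hK : K (ell2_fin n h) @[n --> \oo] --> K h.
  by apply: (continuous_cvg _ (K_cont _)); exact: cvg_ell2_fin.
have hT : T (K (ell2_fin n h)) @[n --> \oo] --> T (K h).
  exact: (continuous_cvg _ (T_cont _)).
by apply: cvgB; apply: cvg_inner => //; exact: cvg_cst.
Qed.

Lemma continuous_fin_energy n :
  continuous (fun x : 'rV[R]_n.+1 => fin_energy n.+1 (fun i => x 0 (inord i))).
Proof.
move=> x; rewrite /fin_energy.
have cx i : (z : 'rV[R]_n.+1) 0 (inord i) @[z --> x] --> x 0 (inord i).
  exact: coord_continuous.
have hf : ell2_fin n.+1 (fun i => (z : 'rV[R]_n.+1) 0 (inord i)) @[z --> x] -->
    ell2_fin n.+1 (fun i => x 0 (inord i)).
  apply: (cvg_big (@add_continuous _) (nbhs_filter x)) => i _.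
  by apply: cvgZr_tmp; exact: cx.
have FF := nbhs_filter x.
have hK := continuous_cvg FF (K_cont _) hf.
have hT := continuous_cvg FF (T_cont _) hK.
apply: cvgD.
  apply: cvgB; last by apply: cvg_inner => //; exact: cvg_cst.
  by apply: cvgM; [exact: cvg_cst|rewrite expr2; apply: cvgM; apply: cvg_norm].
apply: (cvg_big (@add_continuous _) (nbhs_filter x)) => i _.
by apply: cvg_norm.
Qed.

(** The extreme value theorem applies on the cube of half-width D. A competitor of energy at most 0
    lies in the cube by hypothesis; any other loses to the origin, whose energy is 0. *)
Lemma fin_energy_min n (D : R) :
  (forall c, fin_energy n.+1 c <= 0 -> \sum_(0 <= i < n.+1) `|c i| <= D) ->
  exists c, forall c', fin_energy n.+1 c <= fin_energy n.+1 c'.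
Proof.
move=> FD.
have F0 := fin_energy0 n.+1.
have D0 : 0 <= D.
  by have := FD (fun=> 0); rewrite F0 big1 => [|i _]; [exact|rewrite normr0].
pose box := [set x : 'rV[R]_n.+1 | forall i, [set` `[- D, D]] (x ord0 i)].
have box_ne : box !=set0 by exists 0 => i; rewrite /= mxE in_itv /= oppr_le0 D0.
have box_cpt : compact box.
  apply: (@rV_compact R n.+1 (fun=> [set` `[- D, D]])) => _.
  exact: segment_compact.
have Fc := continuous_subspaceT (continuous_fin_energy n).
have [x _ xmin] := EVT_min_rV box_ne box_cpt (Fc _).
exists (fun i => x 0 (inord i)) => c'.
have row_energy (c : nat -> R) : fin_energy n.+1
    (fun i => (\row_(j < n.+1) c j : 'rV[R]_n.+1) 0 (inord i)) =
    fin_energy n.+1 c.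
  rewrite /fin_energy /ell2_fin; congr (quad _ + _);
    by apply: eq_big_nat => i /= ni; rewrite mxE inordK.
have [c'0|c'0] := leP (fin_energy n.+1 c') 0; last first.
  apply: le_trans (ltW c'0); rewrite -F0 -(row_energy (fun=> 0)); apply: xmin.
  by apply/mem_set => i; rewrite /= mxE in_itv /= oppr_le0 D0.
rewrite -(row_energy c'); apply: xmin; apply/mem_set => i.
rewrite /= mxE in_itv /= -ler_norml; apply: le_trans (FD _ c'0).
rewrite (bigD1_seq (i : nat)) ?mem_index_iota ?iota_uniq//= ?ltn_ord//.
by rewrite lerDl; apply: sumr_ge0.
Qed.

(** Coordinatewise optimality makes every such term nonnegative, and continuity of the derivative
    makes the series of all terms sum to the right-hand side, which therefore dominates each one. *)
Lemma subgradient_gap (u v : ell2 R) (mu mv : R) (j : nat) :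
  ell1_norm u = mu%:E -> ell1_norm v = mv%:E ->
  (forall i s, 0 <= s * quad_diff u (ell2_basis i) + `|u i + s| - `|u i|) ->
  (v j - u j) * quad_diff u (ell2_basis j) + `|v j| - `|u j| <=
  quad_diff u (v - u) + mv - mu.
Proof.
move=> um vm opt.
pose t i := (v i - u i) * quad_diff u (ell2_basis i) + `|v i| - `|u i|.
have t0 i : 0 <= t i.
  by have := opt i (v i - u i); rewrite [u i + _]addrC subrK.
have ct : \sum_(0 <= i < n) t i @[n --> \oo] --> quad_diff u (v - u) + mv - mu.
  rewrite (_ : (fun _ => _) = fun n => quad_diff u (ell2_fin n (v - u))
     + \sum_(0 <= i < n) `|v i| - \sum_(0 <= i < n) `|u i|); last first.
    by apply/funext => n; rewrite quad_diff_fin -big_split -sumrB.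
  apply: cvgB; last exact: ell1_norm_cvg.
  by apply: cvgD; [exact: cvg_quad_diff|exact: ell1_norm_cvg].
rewrite -/(t j) -(cvg_lim _ ct)//; apply: limr_ge; first exact: cvgP ct.
exists j.+1 => // n /= jn.
rewrite (bigD1_seq j) ?mem_index_iota ?iota_uniq//= lerDl.
by apply: sumr_ge0.
Qed.

End l1_minimization.

Section l1_minimizer.
Context {R : realType} {Y : hilbertType R}.
Variables (K : {linear ell2 R -> Y}) (T : {linear Y -> Y}) (y : Y).

(** With q = |T K u| and |u| <= m, half of m absorbs the linear term and leaves q^2 - 2 c q + m <=
    0. Both bounds follow, the second by completing the square. *)
Lemma sublevel_bound (c : R) (u : ell2 R) (m : R) :
  0 <= c ->
  (forall w, `|inner y (K w)| <= 2^-1 * `|w| + c * `|T (K w)|) ->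
  ell1_norm u = m%:E -> quad K T y u + m <= 0 ->
  `|T (K u)| <= 2 * c /\ m <= c ^+ 2.
Proof.
move=> c0 yK um; rewrite /quad => Qm.
have m0 : 0 <= m by rewrite -lee_fin -um ell1_norm_ge0.
have arith (q w z : R) : 0 <= q -> w <= m -> z <= 2^-1 * w + c * q ->
    2^-1 * q ^+ 2 - z + m <= 0 -> q <= 2 * c /\ m <= c ^+ 2.
  move=> q0 wm zw Qm'.
  have h : q ^+ 2 - 2 * c * q + m <= 0 by lra.
  split; last by have := sqr_ge0 (q - c); nra.
  rewrite leNgt; apply/negP => cq.
  have : 0 < (q - 2 * c) * q.
    by rewrite mulr_gt0 ?subr_gt0 ?(le_lt_trans _ cq) ?mulr_ge0.
  by rewrite mulrBl; move: h m0; lra.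
apply: (arith _ `|u| _) Qm => //; first exact: ell2_norm_le_ell1 um.
exact: le_trans (ler_norm _) (yK u).
Qed.

(** Moving coordinate i by l s with 0 < l <= 1 changes the energy by at most l (X + l k), by
    convexity of the absolute value; small l then forces X >= 0. *)
Lemma fin_energy_min_subgradient n (c : nat -> R) :
  (forall c', fin_energy K T y n c <= fin_energy K T y n c') ->
  forall i s, (i < n)%N ->
  0 <= s * quad_diff K T y (ell2_fin n c) (ell2_basis i) + `|c i + s| - `|c i|.
Proof.
move=> cmin i s lin; set g := quad_diff _ _ _ _ _.
set X := (X in 0 <= X).
pose k := 2^-1 * (s ^+ 2 * `|T (K (ell2_basis i))| ^+ 2).
have k0 : 0 <= k by rewrite mulr_ge0 ?invr_ge0// -exprMn sqr_ge0.
have hl l : 0 < l -> l <= 1 -> 0 <= X + l * k.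
  move=> l0 l1; rewrite -(pmulr_rge0 _ l0).
  have := cmin (fun j => c j + l * s * (j == i)%:R).
  rewrite /fin_energy ell2_fin_shift//.
  rewrite (quad_expand K T y (ell2_fin n c) (_ + _)).
  rewrite [_ + _ *: _ - _]addrAC subrr add0r quad_diffZ -/g.
  rewrite (linearZ_LR K) (linearZ_LR T) normrZ exprMn real_normK ?num_real//.
  have -> : \sum_(0 <= j < n) `|c j + l * s * (j == i)%:R| =
      \sum_(0 <= j < n) `|c j| + (`|c i + l * s| - `|c i|).
    apply/eqP; rewrite addrC -subr_eq -sumrB; apply/eqP.
    rewrite (bigD1_seq i) ?mem_index_iota ?iota_uniq//= eqxx mulr1.
    by rewrite big1 ?addr0// => j /negPf ->; rewrite mulr0 addr0 subrr.
  have convex : `|c i + l * s| <= (1 - l) * `|c i| + l * `|c i + s|.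
    have -> : c i + l * s = (1 - l) * c i + l * (c i + s) by ring.
    rewrite (le_trans (ler_normD _ _))// !normrM (gtr0_norm l0).
    by rewrite ger0_norm ?subr_ge0.
  by move: convex; rewrite /X /k; lra.
rewrite leNgt; apply/negP => X0.
have kX : 0 < k - X by lra.
(* At this l, X + l k equals -X^2 / (k - X), which is negative. *)
have := hl (- X / (k - X)).
rewrite divr_gt0 ?oppr_gt0// ler_pdivrMr// mul1r => /(_ isT).
have -> : - X <= k - X by lra.
move=> /(_ isT); rewrite -(pmulr_lge0 _ kX) mulrDl mulrAC divfK ?gt_eqF//.
have : 0 < X * X by rewrite nmulr_rgt0.
by lra.
Qed.

Lemma l1_minimizer :
  compact_operator K -> bounded_operator T -> injective T ->
  (forall I : {fset nat}, {in ell2_span I &, injective (T \o K)}) ->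
  exists u, forall v,
    ((quad K T y u)%:E + ell1_norm u <= (quad K T y v)%:E + ell1_norm v)%E /\
    ((quad K T y v)%:E + ell1_norm v <= (quad K T y u)%:E + ell1_norm u ->
     v = u)%E.
Proof.
move=> Kc Tb Tinj fbi; have Kb := compact_operator_bounded _ Kc.
have [c c0 cK] := compact_operator_inner_le K T y 2^-1 Kc Tb Tinj ltac:(lra).
have [b Tb'] := Tb.
(* Once |T K u| <= 2 c, Cauchy-Schwarz bounds the derivative at u along e_i by this expression. *)
have [N _ HN] : \forall i \near \oo,
    (2 * c * b + `|y|) * `|K (ell2_basis i)| < 2^-1.
  have h : (2 * c * b + `|y|) * `|K (ell2_basis i)| @[i --> \oo] --> (0 : R).
    rewrite -[0](mulr0 (2 * c * b + `|y|)); apply: cvgM; first exact: cvg_cst.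
    exact: compact_operator_basis.
  by apply: (cvgr_lt _ h); rewrite invr_gt0.
(* Taking N + 1 coordinates keeps the dimension positive even if N = 0. *)
have [a amin] := fin_energy_min K T y Kb Tb N (c ^+ 2) (fun a h =>
  (sublevel_bound c _ _ c0 cK (ell1_norm_fin _ a) h).2).
set u := ell2_fin N.+1 a in amin.
have um := ell1_norm_fin N.+1 a; rewrite -/u in um.
set mu := \sum_(_ <= _ < _) _ in um.
have F0 : fin_energy K T y N.+1 a <= 0.
  by rewrite -(fin_energy0 K T y N.+1); exact: amin.
have [uq _] := sublevel_bound _ _ _ c0 cK um F0.
have tail i : (N < i)%N -> `|quad_diff K T y u (ell2_basis i)| < 2^-1.
  move=> Ni; apply: le_lt_trans (HN i (ltnW Ni)).
  rewrite (le_trans (ler_normB _ _))// mulrDl lerD//; last first.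
    exact: cauchy_schwarz.
  rewrite (le_trans (cauchy_schwarz _ _))// -mulrA ler_pM//.
(* Up to N this is finite-dimensional minimality; beyond N, u_i = 0 and |s| outweighs a slope below
   1/2. *)
have opt i s : 0 <= s * quad_diff K T y u (ell2_basis i) + `|u i + s| - `|u i|.
  rewrite ell2_fin_coord; case: ltnP => iN.
    exact: fin_energy_min_subgradient.
  rewrite add0r normr0 subr0.
  have := tail i iN.
  have := ler_norm (- (s * quad_diff K T y u (ell2_basis i))).
  by rewrite normrN normrM; have : 0 <= `|s| by []; nra.
have gap v mv j : ell1_norm v = mv%:E ->
    (v j - u j) * quad_diff K T y u (ell2_basis j) + `|v j| - `|u j| +
    2^-1 * `|T (K (v - u))| ^+ 2 <= (quad K T y v + mv) - (quad K T y u + mu).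
  move=> vm; have := subgradient_gap K T y Kb Tb u v mu mv j um vm opt.
  by rewrite (quad_expand _ _ _ u v); lra.
exists u => v; rewrite um.
have := ell1_norm_ge0 v; case vm : (ell1_norm v) => [mv| |]// _; last first.
  by rewrite addey// leey; split=> //; rewrite -EFinD leye_eq.
rewrite -!EFinD !lee_fin; have gapv j := gap v mv j vm.
have gap0 j :
    0 <= (v j - u j) * quad_diff K T y u (ell2_basis j) + `|v j| - `|u j|.
  by have := opt j (v j - u j); rewrite [u j + _]addrC subrK.
have sq0 := sqr_ge0 `|T (K (v - u))|.
split=> [|vu]; first by have := gapv 0%N; have := gap0 0%N; lra.
have Tvu : T (K v) = T (K u).
  apply/eqP; rewrite -subr_eq0 -!linearB -normr_eq0 -sqrf_eq0 eq_le sq0 andbT.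
  by have := gapv 0%N; have := gap0 0%N; lra.
(* For i > N the gap gives v_i g_i + |v_i| <= 0 with |g_i| < 1/2, g_i being the derivative along
   e_i; hence v_i = 0. *)
have vfin : v = ell2_fin N.+1 v.
  apply/val_inj/funext => i /=; rewrite ell2_fin_coord; case: ltnP => // iN.
  have := gapv i; rewrite ell2_fin_coord ltnNge iN /= subr0 normr0 subr0 => h.
  apply/eqP; rewrite -normr_le0.
  have := tail i iN.
  have := ler_norm (- (v i * quad_diff K T y u (ell2_basis i))).
  by rewrite normrN normrM; have : 0 <= `|v i| by []; nra.
have spanP w : ell2_fin N.+1 w \in ell2_span [fset i in iota 0 N.+1]%fset.
  apply/mem_set; exists w; apply: perm_big; rewrite perm_sym.
  by apply: uniq_perm; rewrite ?fset_uniq ?iota_uniq// => i; rewrite !inE.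
rewrite vfin; apply: (fbi [fset i in iota 0 N.+1]%fset); rewrite ?spanP//=.
by rewrite -vfin.
Qed.

End l1_minimizer.

(** * Reduction of the theorem to the operators [K] and [T] *)

Lemma op_invK {R : realType} {V W : normedModType R} (f : V -> W) :
  injective f -> cancel f (op_inv f).
Proof.
by move=> finj x; apply: pinvKV; rewrite ?inE// => ? ? _ _; exact: finj.
Qed.

Lemma compact_operator_comp {R : realType} {U V W : normedModType R}
    (f : V -> W) (g : {linear U -> V}) :
  compact_operator f -> bounded_operator g -> compact_operator (f \o g).
Proof.
move=> [flin fc] [M gM]; split=> [a x z|S [r [_ Sr]]].
  by rewrite /= linearP flin.
(* The absolute values guard against negative constants; |r| + 1 is used because S is bounded by
   every radius above r. *)
rewrite -image_comp; apply: fc; exists (`|M| * (`|r| + 1)).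
split=> // t ht _ [x Sx <-] /=.
apply: le_trans (gM x) (le_trans _ (ltW ht)).
rewrite (le_trans (ler_wpM2r _ (ler_norm M)))// ler_wpM2l//.
by apply: Sr => //; rewrite (le_lt_trans (ler_norm r))// ltrDl.
Qed.

Section covariance.
Context {R : realType} {Y : hilbertType R}.
Context d (Omega : measurableType d) (P : probability Omega R).
Variables (eps : Omega -> Y) (Sigma : Y -> Y).
Hypothesis cov : is_centered_covariance P eps Sigma.

Lemma covariance_symm u v : inner (Sigma u) v = inner u (Sigma v).
Proof.
have [_ _ covE] := cov; apply: EFin_inj; rewrite -covE innerC -covE.
by congr (expectation _ _); apply/funext => w; rewrite mulrC.
Qed.

Lemma covariance_ge0 u : 0 <= inner (Sigma u) u.
Proof.
have [_ _ covE] := cov; rewrite -lee_fin -covE.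
by apply: expectation_ge0 => w; rewrite -expr2 sqr_ge0.
Qed.

End covariance.

Theorem theorem2p3 (R : realType) (X Y : hilbertType R)
    (sepX : separable X) (sepY : separable Y)
    (d : measure_display) (Omega : measurableType d) (P : probability Omega R)
    (eps : Omega -> Y)
    (A : {linear X -> Y}) (Sigma : {linear Y -> Y}) (B : {linear ell2 R -> X})
    (y : Y)
    (A_bounded : bounded_operator A)
    (Sigma_bounded : bounded_operator Sigma)
    (Sigma_covariance : is_centered_covariance P eps Sigma)
    (Sigma_injective : injective Sigma)
    (Sigma_A_compatible : compatible Sigma A)
    (B_bounded : bounded_operator B)
    (AB_FBI : finite_basis_injective (A \o B)) :
  (exists! u : ell2 R, minimizer (tikhonov_l1 Sigma A B y) u) /\
  (exists! x : X,
     exists2 u : ell2 R, minimizer (tikhonov_l1 Sigma A B y) u & x = B u).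
Proof.
have [Tlin Tb Tsym Tge TT] := op_sqrtP Sigma Sigma_bounded
  (covariance_symm _ _ _ _ _ Sigma_covariance)
  (covariance_ge0 _ _ _ _ _ Sigma_covariance).
have [AS AK] := Sigma_A_compatible.
pose T : {linear Y -> Y} := HB.pack (op_sqrt Sigma)
  (GRing.isLinear.Build R Y Y _ (op_sqrt Sigma) Tlin).
have TTE w : T (T w) = Sigma w by have := congr1 (@^~ w) TT.
have Tinj : injective T.
  by move=> u v uv; apply: Sigma_injective; rewrite -!TTE uv.
have Kc := compact_operator_comp _ B AK B_bounded.
pose K : {linear ell2 R -> Y} := HB.pack ((op_inv Sigma \o A) \o B)
  (GRing.isLinear.Build R (ell2 R) Y _ ((op_inv Sigma \o A) \o B) Kc.1).
have SK u : Sigma (K u) = A (B u).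
  have [w _ wE] := AS (A (B u)) ltac:(by exists (B u)).
  by rewrite /= -wE (op_invK _ Sigma_injective).
(* A B u = Sigma K u = T (T K u), so the inverse of T gives T K u and that of Sigma gives K u. *)
have JE u : tikhonov_l1 Sigma A B y u = ((quad K T y u)%:E + ell1_norm u)%E.
  rewrite /tikhonov_l1 -SK -TTE (op_invK _ Tinj) TTE.
  by rewrite (op_invK _ Sigma_injective).
(* Applying T once more turns T K into A B, which is injective on the span. *)
have fbi (I : {fset nat}) : {in ell2_span I &, injective (T \o K)}.
  move=> u v uI vI uv; apply: (AB_FBI I) => //=.
  by rewrite -!SK -!TTE; congr (T _).
have [u0 u0min] := l1_minimizer K T y Kc Tb Tinj fbi.
have min_u0 : minimizer (tikhonov_l1 Sigma A B y) u0.
  by move=> v; rewrite !JE; have [] := u0min v.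
have min_unique v : minimizer (tikhonov_l1 Sigma A B y) v -> v = u0.
  by move=> /(_ u0); rewrite !JE; have [_] := u0min v.
split; first by exists u0; split=> // v /min_unique.
exists (B u0); split; first by exists u0.
by move=> _ [v /min_unique -> ->].
Qed.
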